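(* Let $\Gamma$ be a connected bipartite graph with at least one edge, and suppose that its line graph $G=\mathrm{L}(\Gamma)$ is integral. Then the diameter of $G$ is at most $2\omega(G)$, where $\omega(G)$ is the clique number of $G$.
   Context: All graphs are finite and simple. A graph is integral if all eigenvalues of its adjacency matrix are integers. The line graph $\mathrm{L}(\Gamma)$ has the edges of $\Gamma$ as vertices, two distinct edges being adjacent when they share an endpoint. The clique number $\omega(G)$ is the maximum number of vertices in a complete subgraph of $G$. *)

(* Defs.v *)
From HB Require Import structures.
From mathcomp Require Import all_boot all_order all_algebra all_field.
Set Implicit Arguments.
Unset Strict Implicit.
Unset Printing Implicit Defensive.
Import GRing.Theory Num.Theory.

Record sgraph := SGraph {
  vertex :> finType;
  adj : rel vertex;
  adj_sym : symmetric adj;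
  adj_irr : irreflexive adj }.

Definition edges (G : sgraph) : {set {set G}} :=
  [set [set p.1; p.2] | p : G * G & adj p.1 p.2].

Definition connected_graph (G : sgraph) : Prop :=
  forall x y : G, connect (@adj G) x y.

Definition bipartite (G : sgraph) : Prop :=
  exists A : {set G}, forall x y : G, adj x y -> (x \in A) != (y \in A).

Section LineGraph.
Variable G : sgraph.

Definition line_vertex : finType := {a : {set G} | a \in edges G}.

Definition line_adj : rel line_vertex :=
  fun a b => (a != b) && (val a :&: val b != set0).

Fact line_adj_sym : symmetric line_adj.
Proof. by move=> a b; rewrite /line_adj eq_sym setIC. Qed.

Fact line_adj_irr : irreflexive line_adj.
Proof. by move=> a; rewrite /line_adj eqxx. Qed.

Definition line_graph : sgraph := SGraph line_adj_sym line_adj_irr.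
End LineGraph.

(* Rows and columns follow the enumeration of the vertex type. *)
Definition adj_mx (R : nzRingType) (G : sgraph) : 'M[R]_#|G| :=
  \matrix_(i, j) (adj (enum_val i) (enum_val j))%:R%R.

(* The entries are integers, so every complex eigenvalue is algebraic and
   algC contains the whole spectrum. *)
Definition integral_graph (G : sgraph) : Prop :=
  forall a : algC, eigenvalue (adj_mx algC G) a -> a \is a Num.int.

Definition has_walk (G : sgraph) (x y : G) (n : nat) : bool :=
  [exists p : n.-tuple G, path (@adj G) x p && (last x p == y)].

(* The least length of a walk from x to y.  A shortest walk has length less
   than #|G|, so the value #|G| arises exactly when y is unreachable from x. *)
Definition dist (G : sgraph) (x y : G) : nat :=
  find (has_walk x y) (iota 0 #|G|).

Definition diameter (G : sgraph) : nat :=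
  \max_(x : G) \max_(y : G) dist x y.

Definition clique (G : sgraph) (K : {set G}) : bool :=
  [forall x in K, forall y in K, (x != y) ==> adj x y].

Definition clique_number (G : sgraph) : nat :=
  \max_(K : {set G} | clique K) #|K|.

(* Main.v *)
Require Import Defs.
From mathcomp Require Import all_boot.
From mathcomp Require Import all_order all_algebra all_field.

(** If [w] is the clique number of [L(Gamma)], the spectrum of [L(Gamma)] lies in
    [[-2, 2w - 2]]: the lower bound holds because [A + 2 = N N^T] for the
    edge-vertex incidence matrix [N], the upper bound because the neighbours of an
    edge [uv] lie in the two cliques formed by the edges at [u] and the edges at
    [v].  Integrality leaves at most [2w + 1] distinct eigenvalues, so the
    symmetric matrix [A] satisfies a monic polynomial of degree [2w + 1].  If two
    vertices were at distance [d > 2w], this polynomial times a power of ['X]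
    would express [A ^+ d] through lower powers of [A], all of which vanish at the
    corresponding entry, whereas [A ^+ d] does not. *)

Set Implicit Arguments.
Unset Strict Implicit.
Unset Printing Implicit Defensive.

(** * Eigenvalue bounds and annihilating polynomials of complex matrices *)

Section Spectra.
Import Order.TTheory GRing.Theory Num.Theory.
Local Open Scope ring_scope.
Local Open Scope sesquilinear_scope.

Lemma natr_card_enum_val (R : pzSemiRingType) (T : finType) (A : {pred T}) :
  #|A|%:R = \sum_(k < #|T|) (enum_val k \in A)%:R :> R.
Proof.
rewrite (reindex enum_rank) /=; last exact/onW_bij/enum_rank_bij.
rewrite -sum1_card natr_sum big_mkcond; apply: eq_bigr => z _.
by rewrite enum_rankK; case: (z \in A).
Qed.

Lemma horner_mx_coef (R : comNzRingType) n (A : 'M[R]_n.+1) (p : {poly R}) :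
  horner_mx A p = \sum_(i < size p) p`_i *: A ^+ i.
Proof.
rewrite -{1}[p]coefK poly_def raddf_sum; apply: eq_bigr => i _ /=.
by rewrite linearZ /= rmorphXn /= horner_mx_X.
Qed.

(** Eigenvectors here are row vectors, so absolute row sums of [A] bound its action in the l1 norm:
    compare the l1 norms of [v *m A] and [v]. *)
Lemma norm_eigenvalue_le (R : numFieldType) n (A : 'M[R]_n) (a c : R) :
  (forall i, \sum_j `|A i j| <= c) -> eigenvalue A a -> `|a| <= c.
Proof.
move=> rowA /eigenvalueP[v vA vn0].
have v_gt0 : 0 < \sum_j `|v 0 j|.
  rewrite lt_def sumr_ge0 ?andbT; last by move=> *; apply: normr_ge0.
  rewrite psumr_neq0; last by move=> *; apply: normr_ge0.
  case/rV0Pn: vn0 => j vj; apply/hasP; exists j; first exact: mem_index_enum.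
  by rewrite /= normr_gt0.
rewrite -(ler_pM2r v_gt0) !mulr_sumr.
apply: (@le_trans _ _ (\sum_j \sum_i `|v 0 i| * `|A i j|)).
  apply: ler_sum => j _; move/rowP/(_ j): vA; rewrite !mxE -normrM => <-.
  by apply: le_trans (ler_norm_sum _ _ _) _; apply: ler_sum => i _; rewrite normrM.
rewrite exchange_big; apply: ler_sum => i _.
by rewrite -mulr_sumr mulrC ler_wpM2r.
Qed.

(** For an eigenvector [v], [a] times the squared norm of [v] is the squared norm of [v *m B]. *)
Lemma gram_eigenvalue_ge0 (C : numClosedFieldType) m n (B : 'M[C]_(m, n)) a :
  eigenvalue (B *m B ^t*) a -> 0 <= a.
Proof.
case/eigenvalueP=> v vB /(@dotmx_is_dotmx C) v_gt0.
rewrite -(pmulr_lge0 _ v_gt0).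
suff -> : a * dotmx v v = dotmx (v *m B) (v *m B) by apply: dnorm_ge0.
rewrite !dotmxE trmx_mul map_mxM mulmxA -[v *m B *m _]mulmxA vB.
by rewrite -scalemxAl [RHS]mxE.
Qed.

Lemma eigenvalue_addr_scalar (F : fieldType) n (A : 'M[F]_n) a c :
  eigenvalue A a -> eigenvalue (A + c%:M) (a + c).
Proof.
case/eigenvalueP=> v vA vn0; apply/eigenvalueP; exists v => //.
by rewrite mulmxDr vA mul_mx_scalar scalerDl.
Qed.

(** After unitary diagonalisation the polynomial acts entrywise on the diagonal, and each diagonal
    entry is an eigenvalue, hence a root. *)
Lemma horner_mx_prod_eigenvalues (C : numClosedFieldType) n (A : 'M[C]_n.+1) rs :
  A \is normalmx -> (forall a, eigenvalue A a -> a \in rs) ->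
  horner_mx A (\prod_(r <- rs) ('X - r%:P)) = 0.
Proof.
move=> /orthomx_spectralP; have := spectral_unit A.
set P := spectralmx A; set d := spectral_diag A => uP defA eigA.
rewrite defA horner_mx_uconjC // horner_mx_diag.
suff -> : map_mx (horner (\prod_(r <- rs) ('X - r%:P))) d = 0.
  by rewrite raddf0 mulmx0 mul0mx.
apply/rowP=> j; rewrite !mxE; apply/eqP.
rewrite -/(root _ _) root_prod_XsubC; apply: eigA.
(* As [A] is [invmx P] times the diagonal matrix times [P], the rows of [P] are left eigenvectors;
   they are nonzero because [P] is invertible. *)
apply/eigenvalueP; exists (row j P); last first.
  apply/negP=> /eqP rj0; have := rowE j P.
  move/(congr1 (mulmx^~ (invmx P))); rewrite rj0 mul0mx mulmxK // => /rowP/(_ j)/eqP.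
  by rewrite !mxE !eqxx eq_sym oner_eq0.
rewrite {1}defA -row_mul -mulmxA mulKVmx //.
by apply/rowP=> k; rewrite !mxE (bigD1 j) //= mxE eqxx mulr1n big1 ?addr0 ?mxE //;
  move=> i ij; rewrite mxE eq_sym (negPf ij) mul0r.
Qed.

Lemma normalmx_power_entry0 (C : numClosedFieldType) n (A : 'M[C]_n) rs d i j :
  A \is normalmx -> (forall a, eigenvalue A a -> a \in rs) -> (size rs <= d)%N ->
  (forall k, (k < d)%N -> (A ^+ k) i j = 0) -> (A ^+ d) i j = 0.
Proof.
case: n A i j => [A []//|n] A i j nA eigA rs_d Ak0.
(* The power of ['X] pads the degree to exactly [d]. *)
set p := 'X^(d - size rs) * \prod_(r <- rs) ('X - r%:P).
have p_mon : p \is monic by rewrite monicMl ?monicXn ?monic_prod_XsubC.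
have sz_p : size p = d.+1.
  by rewrite size_monicM ?monicXn ?monic_neq0 ?monic_prod_XsubC // size_polyXn
    size_prod_XsubC addnS /= addSn subnK.
have : horner_mx A p = 0 by rewrite rmorphM /= horner_mx_prod_eigenvalues ?mulr0.
rewrite horner_mx_coef sz_p big_ord_recr /= => /matrixP/(_ i j).
have -> : p`_d = 1 by have := monicP p_mon; rewrite lead_coefE sz_p.
rewrite scale1r !mxE summxE big1 ?add0r // => k _.
by rewrite mxE Ak0 ?mulr0.
Qed.

End Spectra.

(** * Walks, distances and powers of the adjacency matrix *)

Section Walks.
Variable G : sgraph.
Implicit Types x y z : G.

Lemma has_walkP x y n :
  reflect (exists p, [/\ size p = n, path (@adj G) x p & last x p = y])
          (has_walk x y n).
Proof.
apply: (iffP existsP) => [[p /andP[xp /eqP pE]]|[p [sz_p xp pE]]].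
  by exists p; rewrite size_tuple.
by exists (tcast sz_p (in_tuple p)); rewrite val_tcast xp pE eqxx.
Qed.

Lemma has_walkS x y n :
  has_walk x y n.+1 = [exists z, adj x z && has_walk z y n].
Proof.
apply/has_walkP/existsP => [[[|z p] []// [sz_p] /andP[xz zp] pE]|].
  by exists z; rewrite xz; apply/has_walkP; exists p.
case=> z /andP[xz /has_walkP[p [sz_p zp pE]]].
by exists (z :: p); rewrite /= sz_p xz.
Qed.

Lemma has_walk_dist x y : connected_graph G -> has_walk x y (dist x y).
Proof.
move=> /(_ x y)/connectP[p0 xp0 ->]; case: (shortenP xp0) => p xp Up _.
(* A walk without repeated vertices is short enough for its length to lie in the range that [dist]
   searches, so [find] does not return its default. *)
have sz_p : size p < #|G| by have := uniq_leq_size Up (fun z _ => mem_enum G z);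
  rewrite -cardE.
have has_p : has (has_walk x (last x p)) (iota 0 #|G|).
  apply/hasP; exists (size p); first by rewrite mem_iota.
  by apply/has_walkP; exists p.
have := nth_find 0 has_p; rewrite nth_iota // -[X in _ < X](size_iota 0).
by rewrite -has_find.
Qed.

Lemma has_walk_lt_dist x y n : n < dist x y -> has_walk x y n = false.
Proof.
move=> n_lt; have := before_find 0 n_lt; rewrite nth_iota ?add0n //.
by rewrite (leq_trans n_lt) // -[X in _ <= X](size_iota 0) find_size.
Qed.

Lemma clique_leq_clique_number (K : {set G}) : clique K -> #|K| <= clique_number G.
Proof. exact: (@leq_bigmax_cond _ (@clique G) (fun K : {set G} => #|K|)). Qed.

Import Order.TTheory GRing.Theory Num.Theory.
Local Open Scope ring_scope.

Lemma adj_mx_tr (R : nzRingType) : (adj_mx R G)^T = adj_mx R G.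
Proof. by apply/matrixP=> i j; rewrite !mxE adj_sym. Qed.

Lemma adj_mx_normal (C : numClosedFieldType) : adj_mx C G \is normalmx.
Proof.
apply/normalmxP; rewrite adj_mx_tr.
suff -> : map_mx (@Num.conj C) (adj_mx C G) = adj_mx C G by [].
by apply/matrixP=> i j; rewrite !mxE conjC_nat.
Qed.

Lemma adj_mx_power_ge0 (R : numDomainType) n i j : 0 <= (adj_mx R G ^+ n) i j.
Proof.
elim: n i => [|n IHn] i; first by rewrite expr0 mxE ler0n.
by rewrite exprS mxE sumr_ge0 // => k _; rewrite mulr_ge0 // mxE ler0n.
Qed.

(** The entry counts walks, but only its vanishing matters: a sum of nonnegative terms is zero
    exactly when every term is, which matches the recursion on the first step of a walk. *)
Lemma adj_mx_power_eq0 (R : numDomainType) n x y :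
  ((adj_mx R G ^+ n) (enum_rank x) (enum_rank y) == 0) = ~~ has_walk x y n.
Proof.
elim: n x => [|n IHn] x.
  rewrite expr0 mxE (inj_eq enum_rank_inj) pnatr_eq0 eqb0; congr (~~ _).
  by apply/eqP/has_walkP => [->|[[|z p] []] //]; exists [::].
rewrite exprS mxE (reindex enum_rank) /=; last exact/onW_bij/enum_rank_bij.
rewrite psumr_eq0 => [|z _]; last by rewrite mulr_ge0 ?adj_mx_power_ge0 // mxE ler0n.
have termE z : (adj_mx R G (enum_rank x) (enum_rank z) *
    (adj_mx R G ^+ n) (enum_rank z) (enum_rank y) == 0) =
    ~~ (adj x z && has_walk z y n).
  by rewrite mulf_eq0 IHn mxE !enum_rankK pnatr_eq0 eqb0 negb_and.
rewrite has_walkS negb_exists; apply/allP/forallP => no_walk z; last first.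
  by move=> _; rewrite /= termE no_walk.
by rewrite -termE; apply: no_walk (mem_index_enum z).
Qed.

Lemma dist_lt_num_eigenvalues (C : numClosedFieldType) (rs : seq C) x y :
  connected_graph G -> (forall a, eigenvalue (adj_mx C G) a -> a \in rs) ->
  (dist x y < size rs)%N.
Proof.
move=> connG eigA; rewrite ltnNge; apply/negP=> rs_le.
have := has_walk_dist x y connG.
apply/negP; rewrite -(adj_mx_power_eq0 C); apply/eqP.
apply: normalmx_power_entry0 rs_le _ => [|//|k k_lt]; first exact: adj_mx_normal.
by apply/eqP; rewrite adj_mx_power_eq0 has_walk_lt_dist.
Qed.

End Walks.

(** * Connectedness and spectrum of line graphs *)

Section LineGraphs.
Variable Gamma : sgraph.
Local Notation L := (line_graph Gamma).
Implicit Types e f : L.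

Definition star (u : Gamma) : {set L} := [set e : L | u \in val e].

Lemma edgesP (a : {set Gamma}) :
  reflect (exists u v, adj u v /\ a = [set u; v]) (a \in edges Gamma).
Proof.
apply: (iffP imsetP) => [[[u v]]|[u [v [uv ->]]]].
  by rewrite inE /= => uv ->; exists u, v.
by exists (u, v); rewrite ?inE.
Qed.

Lemma card_edge e : #|val e| = 2.
Proof.
have /edgesP[u [v [uv ->]]] := valP e; rewrite cards2.
by case: eqP uv => // ->; rewrite adj_irr.
Qed.

Lemma star_clique u : clique (star u).
Proof.
apply/forall_inP=> e; rewrite inE => ue; apply/forall_inP=> f; rewrite inE => uf.
apply/implyP=> ef; apply/andP; split=> //.
by apply/set0Pn; exists u; rewrite inE ue.
Qed.

(** Two edges with both endpoints in common coincide. These cardinals are the entries of the Gram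
    matrix of the incidence matrix. *)
Lemma card_edgeI e f : #|val e :&: val f| = 2 * (e == f) + adj e f.
Proof.
rewrite /= /line_adj; have [<-|nef] := eqVneq e f; first by rewrite setIid card_edge.
rewrite -card_gt0 muln0 add0n /=.
suff : #|val e :&: val f| < 2 by case: #|_| => [|[]].
rewrite ltnNge; apply: contra nef => le2.
have eI : val e :&: val f = val e by apply/eqP; rewrite eqEcard subsetIl card_edge.
have fI : val e :&: val f = val f by apply/eqP; rewrite eqEcard subsetIr card_edge.
by apply/eqP/val_inj; rewrite /= -eI fI.
Qed.

(** The summand 2 counts [e] twice: once in the union of the stars at its endpoints, once in their
    intersection. *)
Lemma line_degree e : #|[set f | adj e f]| + 2 <= 2 * clique_number L.
Proof.
have /edgesP[u [v [uv eE]]] := valP e.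
have eu : e \in star u by rewrite inE eE set21.
have ev : e \in star v by rewrite inE eE set22.
have sub : e |: [set f | adj e f] \subset star u :|: star v.
  apply/subsetP=> f; rewrite in_setU1 => /predU1P[->|]; first by rewrite inE eu.
  rewrite inE => /andP[_ /set0Pn[w]]; rewrite inE eE => /andP[/set2P[]-> wf];
  by rewrite !inE wf ?orbT.
have := subset_leq_card sub; rewrite cardsU1 inE adj_irr add1n => nbr_le.
have I_gt0 : 0 < #|star u :&: star v| by apply/card_gt0P; exists e; rewrite inE eu.
rewrite mul2n -addnn addn2 -addn1.
apply: leq_trans (leq_add nbr_le I_gt0) _; rewrite cardsUI.
by rewrite leq_add ?clique_leq_clique_number ?star_clique.
Qed.

Lemma line_graph_connected : connected_graph Gamma -> connected_graph L.
Proof.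
move=> connG e f.
have /edgesP[u [u' [uu' eE]]] := valP e; have /edgesP[v [v' [vv' fE]]] := valP f.
have common w (g h : L) : w \in val g -> w \in val h -> connect (@adj L) g h.
  move=> wg wh; have [->//|ngh] := eqVneq g h; apply: connect1.
  by apply/andP; split=> //; apply/set0Pn; exists w; rewrite inE wg.
have /connectP[p] := connG u v.
have : u \in val e by rewrite eE set21.
have : v \in val f by rewrite fE set21.
(* Induction along a walk of [Gamma] from an endpoint of [e] to one of [f]: its first edge meets [e]
   and takes the place of [e]. *)
clear -common; elim: p u e => /= [|w p IHp] u e vf ue.
  by move=> _ vu; apply: common ue _; rewrite -vu.
move=> /andP[uw wp] vE.
have uwE : [set u; w] \in edges Gamma by apply/edgesP; exists u, w.
pose g : L := Sub [set u; w] uwE.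
apply: (@connect_trans _ _ g); first by apply: common ue _; rewrite /= set21.
by apply: IHp vf _ wp vE; rewrite /= set22.
Qed.

Import Order.TTheory GRing.Theory Num.Theory.
Local Open Scope ring_scope.
Local Open Scope sesquilinear_scope.

Definition incidence_mx (R : nzRingType) : 'M[R]_(#|L|, #|Gamma|) :=
  \matrix_(i, j) (enum_val j \in val (enum_val i : L))%:R.

Lemma incidence_mx_gram (C : numClosedFieldType) :
  incidence_mx C *m (incidence_mx C) ^t* = adj_mx C L + 2%:M.
Proof.
apply/matrixP=> i j; rewrite !mxE.
transitivity (#|val (enum_val i) :&: val (enum_val j)|%:R : C).
  rewrite natr_card_enum_val; apply: eq_bigr => k _.
  by rewrite !mxE conjC_nat -natrM mulnb !inE.
rewrite card_edgeI natrD addrC (inj_eq enum_val_inj).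
by rewrite natrM mulr_natr.
Qed.

Lemma line_graph_eigenvalue (a : algC) :
  eigenvalue (adj_mx algC L) a -> a \is a Num.int ->
  a \in [seq n%:R - 2 | n <- iota 0 (2 * clique_number L).+1].
Proof.
move=> eig_a int_a.
have a2_ge0 : 0 <= a + 2.
  apply: (@gram_eigenvalue_ge0 _ _ _ (incidence_mx algC)).
  by rewrite incidence_mx_gram; apply: eigenvalue_addr_scalar.
have a2_le : a + 2 <= (2 * clique_number L)%:R.
  rewrite -lerBrDr; apply: le_trans (real_ler_norm (Rreal_int int_a)) _.
  apply: norm_eigenvalue_le eig_a => i; rewrite lerBrDr.
  apply: le_trans (_ : (#|[set f | adj (enum_val i) f]| + 2)%:R <= _); last first.
    by rewrite ler_nat line_degree.
  rewrite natrD lerD2r natr_card_enum_val.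
  by apply: ler_sum => k _; rewrite mxE inE normr_nat.
(* Integrality makes [a + 2] one of the naturals from 0 to [2 * clique_number L]. *)
have : a + 2 \is a Num.nat by rewrite natrEint a2_ge0 rpredD // rpred_nat.
case/natrP=> n an; apply/mapP; exists n; last by rewrite -an addrK.
by rewrite mem_iota leq0n add0n ltnS -(ler_nat algC) -an.
Qed.

End LineGraphs.

Theorem corollary1p6 (Gamma : sgraph)
  (Hconn : connected_graph Gamma)
  (Hbip : bipartite Gamma)
  (Hedge : exists x y : Gamma, adj x y)
  (Hint : integral_graph (line_graph Gamma)) :
  diameter (line_graph Gamma) <= 2 * clique_number (line_graph Gamma).
Proof.
apply/bigmax_leqP=> e _; apply/bigmax_leqP=> f _.
have spec a (eig_a : eigenvalue (adj_mx algC (line_graph Gamma)) a) :=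
  line_graph_eigenvalue eig_a (Hint a eig_a).
have := dist_lt_num_eigenvalues e f (line_graph_connected Hconn) spec.
(* The list of candidates has one entry more than the bound, which the strict inequality absorbs. *)
by rewrite size_map size_iota ltnS.
Qed.
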